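(* Consider the initial value problem for $u=(u_1,u_2,u_3)$ and $p$, with unknowns $u_i,p:\mathbb{R}^3\times(0,+\infty)\to\mathbb{R}$, $$u_t+u\nabla u=-\nabla p,\qquad \operatorname{div}u=0,\qquad u(x,y,z,0)=g(x,y,z),$$ where $g=(g_1,g_2,g_3)$ is of one of the following two forms: (i) $g=(g_1,\;c_1g_1+\tilde c_1,\;c_2g_1+\tilde c_2)$ with $g_1(x,y,z)=G([kc_1+lc_2]x-ky-lz)$, where $c_1,c_2,\tilde c_1,\tilde c_2,k,l\in\mathbb{R}$ and $G:\mathbb{R}\to\mathbb{R}$ is smooth; (ii) $g=\left(g_1,\;g_2,\;\frac1{c_2}g_2-\frac{c_1}{c_2}\right)$ with $g_1(x,y,z)=G(c_2z-y)$, $g_2(x,y,z)=H(c_2z-y)$, where $c_1,c_2\in\mathbb{R}$, $c_2\ne0$, and $G,H:\mathbb{R}\to\mathbb{R}$ are smooth. Then there exists a smooth solution, globally defined in $t>0$. In particular, for any smooth $a,b:\mathbb{R}\to\mathbb{R}$ and $A:\mathbb{R}\to\mathbb{R}$ with $A'=a$ and $A(0)=0$, a solution is given as follows. In case (i): $$u_1=G\big([k\tilde c_1+l\tilde c_2]t+[kc_1+lc_2]x-ky-lz\big)-A(t),\quad u_2=c_1u_1+\tilde c_1,\quad u_3=c_2u_1+\tilde c_2,$$ $$p=a(t)(x+c_1y+c_2z).$$ In case (ii): $$u_1=G(c_1t-y+c_2z),\quad u_2=H(c_1t-y+c_2z)-A(t),\quad u_3=\tfrac1{c_2}H(c_1t-y+c_2z)-\tfrac1{c_2}A(t)-\tfrac{c_1}{c_2},$$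 $$p=a(t)\left(y+\tfrac{z}{c_2}\right)+b(t).$$
   Context: Here $u\nabla u$ denotes the vector with $i$-th component $u_1(u_i)_x+u_2(u_i)_y+u_3(u_i)_z$, and $\nabla$, $\operatorname{div}$ are taken in the space variables $(x,y,z)$. *)

(* Defs.v *)
From HB Require Import structures.
From mathcomp Require Import all_boot all_order all_algebra.
From mathcomp Require Import all_classical all_reals all_analysis.

Set Implicit Arguments.
Unset Strict Implicit.
Unset Printing Implicit Defensive.

Import Order.TTheory GRing.Theory Num.Theory.
Import numFieldNormedType.Exports.
Local Open Scope classical_set_scope.
Local Open Scope ring_scope.

Definition smooth (R : realType) (f : R -> R) : Prop :=
  forall (n : nat) (s : R), derivable (derive1n n f) s 1.

(* Scalar fields in the variables x y z t. They are total functions, but a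
   solution is only constrained on t > 0 (and, for the velocity, at t = 0);
   the values at t < 0 are irrelevant. *)
Definition scalar_field (R : realType) := R -> R -> R -> R -> R.

Definition d_x (R : realType) (f : scalar_field R) : scalar_field R :=
  fun x y z t => derive1 (fun s => f s y z t) x.
Definition d_y (R : realType) (f : scalar_field R) : scalar_field R :=
  fun x y z t => derive1 (fun s => f x s z t) y.
Definition d_z (R : realType) (f : scalar_field R) : scalar_field R :=
  fun x y z t => derive1 (fun s => f x y s t) z.
Definition d_t (R : realType) (f : scalar_field R) : scalar_field R :=
  fun x y z t => derive1 (fun s => f x y z s) t.

(* derive1 is total, so existence of the partial derivatives is a separate
   requirement. *)
Definition partially_derivable (R : realType) (f : scalar_field R) (x y z t : R)
    : Prop :=
  [/\ derivable (fun s => f s y z t) x 1,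
      derivable (fun s => f x s z t) y 1,
      derivable (fun s => f x y s t) z 1 &
      derivable (fun s => f x y z s) t 1].

Definition uncurry4 (R : realType) (f : scalar_field R) : R * R * R * R -> R :=
  fun q => f q.1.1.1 q.1.1.2 q.1.2 q.2.

(* f is of class C^k on the open half-space t > 0. *)
Fixpoint class_C (R : realType) (k : nat) (f : scalar_field R) : Prop :=
  (forall x y z t : R, 0 < t -> {for (x, y, z, t), continuous (uncurry4 f)}) /\
  match k with
  | 0 => True
  | k'.+1 =>
      (forall x y z t : R, 0 < t -> partially_derivable f x y z t) /\
      [/\ class_C k' (d_x f), class_C k' (d_y f),
          class_C k' (d_z f) & class_C k' (d_t f)]
  end.

Definition smooth_field (R : realType) (f : scalar_field R) : Prop :=
  forall k : nat, class_C k f.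

(* The initial value is attained continuously from t > 0. *)
Definition has_initial_value (R : realType) (f : scalar_field R)
    (f0 : R -> R -> R -> R) : Prop :=
  (forall x y z, f x y z 0 = f0 x y z) /\
  {within [set q : R * R * R * R | 0 <= q.2], continuous (uncurry4 f)}.

(* w |-> u_1 w_x + u_2 w_y + u_3 w_z; applied to w = u_i it gives the i-th
   component of u \nabla u. *)
Definition advect (R : realType) (u1 u2 u3 w : scalar_field R) : scalar_field R :=
  fun x y z t => u1 x y z t * d_x w x y z t + u2 x y z t * d_y w x y z t
                 + u3 x y z t * d_z w x y z t.

Definition divergence (R : realType) (u1 u2 u3 : scalar_field R) : scalar_field R :=
  fun x y z t => d_x u1 x y z t + d_y u2 x y z t + d_z u3 x y z t.

Record smooth_solution (R : realType) (g1 g2 g3 : R -> R -> R -> R)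
    (u1 u2 u3 p : scalar_field R) : Prop := {
  sol_smooth_u : [/\ smooth_field u1, smooth_field u2 & smooth_field u3];
  sol_smooth_p : smooth_field p;
  sol_momentum : forall x y z t : R, 0 < t ->
    [/\ d_t u1 x y z t + advect u1 u2 u3 u1 x y z t = - d_x p x y z t,
        d_t u2 x y z t + advect u1 u2 u3 u2 x y z t = - d_y p x y z t &
        d_t u3 x y z t + advect u1 u2 u3 u3 x y z t = - d_z p x y z t];
  sol_div : forall x y z t : R, 0 < t -> divergence u1 u2 u3 x y z t = 0;
  sol_init : [/\ has_initial_value u1 g1, has_initial_value u2 g2 &
                 has_initial_value u3 g3]
}.

Definition primitive0 (R : realType) (A a : R -> R) : Prop :=
  (forall t : R, is_derive t 1 A (a t)) /\ A 0 = 0.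

(* Main.v *)
(* Both families are a plane wave corrected by a function of time,
   u_i = F_i(w) - q_i A(t) with w = alpha x + beta y + gamma z + delta t and
   p = a(t) (q . (x, y, z)) + b(t). If (alpha, beta, gamma) . F = - delta and
   (alpha, beta, gamma) . q = 0, then u . grad transports every function of w
   at speed - delta, which cancels the time derivative of F_i(w), while - q_i a
   is balanced by grad p; differentiating (alpha, beta, gamma) . F = - delta
   gives div u = 0. *)

Require Import Defs.
From mathcomp Require Import all_boot all_order all_algebra.
From mathcomp Require Import all_classical all_reals all_analysis.
From mathcomp Require Import ring.
Import Order.TTheory GRing.Theory Num.Theory.
Import numFieldNormedType.Exports.
Local Open Scope classical_set_scope.
Local Open Scope ring_scope.

(** * Continuity of the coordinate projections *)

Section Projections.
Context {X Y Z : topologicalType}.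

Lemma continuous_fst : continuous (@fst X Y).
Proof. by move=> q; exact: cvg_fst. Qed.

Lemma continuous_snd : continuous (@snd X Y).
Proof. by move=> q; exact: cvg_snd. Qed.

Lemma continuous_fst_comp {h : Z -> X * Y} :
  continuous h -> continuous (fun q => (h q).1).
Proof. by move=> ch q; apply: continuous_comp (ch q) _; exact: cvg_fst. Qed.

Lemma continuous_snd_comp {h : Z -> X * Y} :
  continuous h -> continuous (fun q => (h q).2).
Proof. by move=> ch q; apply: continuous_comp (ch q) _; exact: cvg_snd. Qed.

End Projections.

(** * Smooth functions of one real variable *)

Lemma smooth_derive1 {R : realType} {f : R -> R} : smooth f -> smooth (derive1 f).
Proof. by move=> sf n s; rewrite -derive1Sn; exact: sf. Qed.

Lemma smooth_is_derive {R : realType} {f : R -> R} (sf : smooth f) (s : R) :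
  is_derive s 1 f (derive1 f s).
Proof. by rewrite derive1E; apply: derivableP; exact: (sf 0%N s). Qed.

Lemma smooth_continuous {R : realType} {f : R -> R} : smooth f -> continuous f.
Proof.
by move=> sf s; apply/differentiable_continuous/derivable1_diffP/(sf 0%N s).
Qed.

(** The derivative [c * f' + 0] has the same form again, with [f'] for [f] and [0] for [d], so
    induction on the order works once [c], [d] and [f] are generalized. *)
Lemma smooth_affine {R : realType} {f : R -> R} (c d : R) :
  smooth f -> smooth (fun s => c * f s + d).
Proof.
move=> sf n; elim: n c d f sf => [|n IHn] c d f sf s.
  have := smooth_is_derive sf s => df.
  by rewrite derive1n0; exact: ex_derive.
have -> : derive1n n.+1 (fun s => c * f s + d) =
    derive1n n (fun s => c * derive1 f s + 0).
  rewrite derive1Sn; congr (derive1n n _); apply/funext => r.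
  have df := smooth_is_derive sf r.
  by rewrite derive1E derive_val.
exact: IHn (smooth_derive1 sf) s.
Qed.

Lemma smooth_id {R : realType} : smooth (@id R).
Proof.
have dc n (c : R) : derive1n n.+1 (@cst R R c) = cst 0.
  elim: n => [|n IHn]; last first.
    by rewrite derive1nS IHn; apply/funext => r; rewrite derive1_cst.
  by apply/funext => r; rewrite derive1n1 derive1_cst.
have d1 : derive1 (@id R) = cst (1 : R).
  by apply/funext => r; rewrite derive1_id.
case=> [|[|n]] s.
- exact: derivable_id.
- by rewrite derive1n1 d1; exact: derivable_cst.
- by rewrite derive1Sn d1 dc; exact: derivable_cst.
Qed.

Lemma smooth_primitive {R : realType} {A a : R -> R} :
  primitive0 A a -> smooth a -> smooth A.
Proof.
move=> [dA _] sa; have A'E : derive1 A = a.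
  by apply/funext => s; rewrite derive1E (derive_val (is_derive := dA s)).
case=> [|n] s; last by rewrite derive1Sn A'E; exact: sa.
by rewrite derive1n0; exact: ex_derive.
Qed.

(** * Plane waves, their gradients and the algebra they generate *)

Definition wave {R : realType} (alpha beta gamma delta : R) (F : R -> R) :
    scalar_field R :=
  fun x y z t => F (alpha * x + beta * y + gamma * z + delta * t).

(** A relation rather than four functions: it carries both the existence of the partial derivatives
    and their values. It is imposed for every real [t], so that it yields equalities of fields such
    as [d_x f = fx], which can be differentiated again. *)
Definition has_gradient {R : realType} (f fx fy fz ft : scalar_field R) : Prop :=
  forall x y z t : R,
  [/\ is_derive x 1 (fun s => f s y z t) (fx x y z t),
      is_derive y 1 (fun s => f x s z t) (fy x y z t),
      is_derive z 1 (fun s => f x y s t) (fz x y z t) &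
      is_derive t 1 (fun s => f x y z s) (ft x y z t)].

Section Gradient.
Context {R : realType}.
Implicit Types f g : scalar_field R.

Lemma is_derive_comp_affine {F : R -> R} (c d s : R) (L : R -> R) :
  smooth F -> (forall r, L r = c * r + d) ->
  is_derive s 1 (fun r => F (L r)) (c * derive1 F (L s) + 0).
Proof.
move=> sF LE.
have dF := smooth_is_derive sF (L s).
have dL : is_derive s 1 L c.
  rewrite (_ : L = (fun r => c * r + d)); last exact/funext.
  by apply: is_derive_eq; rewrite addr0; exact: mulr1.
by rewrite addr0 mulrC; exact: is_derive1_comp.
Qed.

(* The summand [0] keeps the derivatives in the form of [smooth_affine]. *)
Lemma has_gradient_wave (alpha beta gamma delta : R) (F : R -> R) :
  smooth F ->
  has_gradient (wave alpha beta gamma delta F)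
    (wave alpha beta gamma delta (fun s => alpha * derive1 F s + 0))
    (wave alpha beta gamma delta (fun s => beta * derive1 F s + 0))
    (wave alpha beta gamma delta (fun s => gamma * derive1 F s + 0))
    (wave alpha beta gamma delta (fun s => delta * derive1 F s + 0)).
Proof.
move=> sF x y z t; rewrite /wave; split.
- by apply: (is_derive_comp_affine _ (beta * y + gamma * z + delta * t)) => // r; ring.
- by apply: (is_derive_comp_affine _ (alpha * x + gamma * z + delta * t)) => // r; ring.
- by apply: (is_derive_comp_affine _ (alpha * x + beta * y + delta * t)) => // r; ring.
- by apply: (is_derive_comp_affine _ (alpha * x + beta * y + gamma * z)) => // r; ring.
Qed.

Lemma has_gradientD f fx fy fz ft g gx gy gz gt :
  has_gradient f fx fy fz ft -> has_gradient g gx gy gz gt ->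
  has_gradient (fun x y z t => f x y z t + g x y z t)
    (fun x y z t => fx x y z t + gx x y z t)
    (fun x y z t => fy x y z t + gy x y z t)
    (fun x y z t => fz x y z t + gz x y z t)
    (fun x y z t => ft x y z t + gt x y z t).
Proof.
move=> df dg x y z t; have [? ? ? ?] := df x y z t; have [? ? ? ?] := dg x y z t.
by split; exact: is_deriveD.
Qed.

Lemma has_gradientM f fx fy fz ft g gx gy gz gt :
  has_gradient f fx fy fz ft -> has_gradient g gx gy gz gt ->
  has_gradient (fun x y z t => f x y z t * g x y z t)
    (fun x y z t => f x y z t * gx x y z t + g x y z t * fx x y z t)
    (fun x y z t => f x y z t * gy x y z t + g x y z t * fy x y z t)
    (fun x y z t => f x y z t * gz x y z t + g x y z t * fz x y z t)
    (fun x y z t => f x y z t * gt x y z t + g x y z t * ft x y z t).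
Proof.
move=> df dg x y z t; have [? ? ? ?] := df x y z t; have [? ? ? ?] := dg x y z t.
by split; exact: is_deriveM.
Qed.

Lemma has_gradientE f fx fy fz ft : has_gradient f fx fy fz ft ->
  [/\ d_x f = fx, d_y f = fy, d_z f = fz & d_t f = ft].
Proof.
move=> df; split; apply/funext => x; apply/funext => y; apply/funext => z;
  apply/funext => t; have [? ? ? ?] := df x y z t;
  by rewrite /d_x /d_y /d_z /d_t derive1E derive_val.
Qed.

Inductive wave_algebra : scalar_field R -> Prop :=
| wave_algebra_wave alpha beta gamma delta F :
    smooth F -> wave_algebra (wave alpha beta gamma delta F)
| wave_algebraD f g : wave_algebra f -> wave_algebra g ->
    wave_algebra (fun x y z t => f x y z t + g x y z t)
| wave_algebraM f g : wave_algebra f -> wave_algebra g ->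
    wave_algebra (fun x y z t => f x y z t * g x y z t).

Arguments wave_algebra_wave {alpha beta gamma delta F}.

Lemma wave_algebra_continuous f : wave_algebra f -> continuous (uncurry4 f).
Proof.
elim=> [alpha beta gamma delta F sF|{}f g _ cf _ cg|{}f g _ cf _ cg] q.
- apply: (@continuous_comp _ _ _ (fun q : R * R * R * R =>
    alpha * q.1.1.1 + beta * q.1.1.2 + gamma * q.1.2 + delta * q.2) F);
    last exact: smooth_continuous.
  have c1 := @continuous_fst (R * R * R)%type R.
  have c11 := continuous_fst_comp c1.
  have c111 := continuous_fst_comp c11.
  have c112 := continuous_snd_comp c11.
  have c12 := continuous_snd_comp c1.
  have c2 := @continuous_snd (R * R * R)%type R.
  apply: cvgD; [apply: cvgD; [apply: cvgD|]|]; apply: cvgMl_tmp.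
  - exact: c111.
  - exact: c112.
  - exact: c12.
  - exact: c2.
- by apply: cvgD; [exact: cf|exact: cg].
- by apply: cvgM; [exact: cf|exact: cg].
Qed.

(** Differentiating a wave only changes its profile [F] into a multiple of [F']; sums and products
    follow by linearity and the Leibniz rule. *)
Lemma wave_algebra_gradient f : wave_algebra f -> exists fx fy fz ft,
  [/\ wave_algebra fx, wave_algebra fy, wave_algebra fz & wave_algebra ft] /\
  has_gradient f fx fy fz ft.
Proof.
elim=> [alpha beta gamma delta F sF|{}f g sf IHf sg IHg|{}f g sf IHf sg IHg].
- do 4 eexists; split; last exact: has_gradient_wave.
  by split; apply/wave_algebra_wave/smooth_affine/smooth_derive1.
- have [fx [fy [fz [ft [[? ? ? ?] df]]]]] := IHf.
  have [gx [gy [gz [gt [[? ? ? ?] dg]]]]] := IHg.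
  by do 4 eexists; split; last exact: has_gradientD df dg; split; exact: wave_algebraD.
- have [fx [fy [fz [ft [[? ? ? ?] df]]]]] := IHf.
  have [gx [gy [gz [gt [[? ? ? ?] dg]]]]] := IHg.
  do 4 eexists; split; last exact: has_gradientM df dg.
  by split; apply: wave_algebraD; exact: wave_algebraM.
Qed.

Lemma wave_algebra_smooth f : wave_algebra f -> smooth_field f.
Proof.
move=> sf k; elim: k f sf => [|k IHk] f sf.
  by split=> // x y z t _; exact: wave_algebra_continuous.
have [fx [fy [fz [ft [[? ? ? ?] df]]]]] := wave_algebra_gradient f sf.
have [dxE dyE dzE dtE] := has_gradientE _ _ _ _ _ df.
split=> [x y z t _|]; first exact: wave_algebra_continuous.
split=> [x y z t _|]; last by rewrite dxE dyE dzE dtE; split; exact: IHk.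
by have [? ? ? ?] := df x y z t; split; exact: ex_derive.
Qed.

End Gradient.

(** * The Euler equations for a transported wave with a time-dependent correction *)

Section TransportedWave.
Context {R : realType} {alpha beta gamma delta q1 q2 q3 : R}.
Context {F1 F2 F3 A a b : R -> R}.
Hypotheses (sF1 : smooth F1) (sF2 : smooth F2) (sF3 : smooth F3).
Hypotheses (sa : smooth a) (sb : smooth b) (Aa : primitive0 A a).
Hypothesis profile : forall s, alpha * F1 s + beta * F2 s + gamma * F3 s = - delta.
Hypothesis orth : alpha * q1 + beta * q2 + gamma * q3 = 0.

(** The correction [- q * A t] is itself written as a wave, with phase [t], which puts the whole
    field in [wave_algebra]. *)
Let velocity q F : scalar_field R := fun x y z t =>
  wave alpha beta gamma delta F x y z t + wave 0 0 0 1 (fun s => - q * A s + 0) x y z t.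

(** The linear form in space is the wave with identity profile and no time component; [a] and [b]
    are waves with phase [t]. *)
Let pressure : scalar_field R := fun x y z t =>
  wave 0 0 0 1 a x y z t * wave q1 q2 q3 0 id x y z t + wave 0 0 0 1 b x y z t.

Let velocityE q F x y z t : velocity q F x y z t =
  F (alpha * x + beta * y + gamma * z + delta * t) - q * A t.
Proof. by rewrite /velocity /wave !mul0r !add0r mul1r addr0 mulNr. Qed.

Let sA q : smooth (fun s => - q * A s + 0).
Proof. exact: smooth_affine (smooth_primitive Aa sa). Qed.

Let velocity_algebra q F : smooth F -> wave_algebra (velocity q F).
Proof.
move=> sF; apply: wave_algebraD; apply: wave_algebra_wave; [exact: sF|exact: sA].
Qed.

Let drift q s : derive1 (fun s => - q * A s + 0) s = - q * a s.
Proof.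
have [dA _] := Aa; have := dA s => dAs.
by rewrite derive1E derive_val addr0.
Qed.

Let d_velocity q F : smooth F ->
  let w x y z t := alpha * x + beta * y + gamma * z + delta * t in
  has_gradient (velocity q F)
    (fun x y z t => alpha * derive1 F (w x y z t))
    (fun x y z t => beta * derive1 F (w x y z t))
    (fun x y z t => gamma * derive1 F (w x y z t))
    (fun x y z t => delta * derive1 F (w x y z t) - q * a t).
Proof.
move=> sF w x y z t.
have := has_gradientD _ _ _ _ _ _ _ _ _ _
  (has_gradient_wave alpha beta gamma delta F sF) (has_gradient_wave 0 0 0 1 _ (sA q)).
move=> /(_ x y z t)[dx dy dz dt].
split; [apply: (is_derive_eq dx)|apply: (is_derive_eq dy)|apply: (is_derive_eq dz)|
  apply: (is_derive_eq dt)];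
  by rewrite /wave drift !mul0r !add0r ?mul1r !addr0 ?mulNr.
Qed.

(** The factors [a] and [b] have zero spatial derivatives, so only the linear form contributes. *)
Let d_pressure x y z t :
  [/\ d_x pressure x y z t = q1 * a t, d_y pressure x y z t = q2 * a t &
      d_z pressure x y z t = q3 * a t].
Proof.
have [-> -> -> _] := has_gradientE _ _ _ _ _ (has_gradientD _ _ _ _ _ _ _ _ _ _
  (has_gradientM _ _ _ _ _ _ _ _ _ _ (has_gradient_wave 0 0 0 1 a sa)
    (has_gradient_wave q1 q2 q3 0 id smooth_id))
  (has_gradient_wave 0 0 0 1 b sb)).
by rewrite /wave derive1_id; split; rewrite !mul0r !add0r mul1r; ring.
Qed.

Let velocity_init q F g : smooth F ->
  (forall x y z, g x y z = F (alpha * x + beta * y + gamma * z)) ->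
  has_initial_value (velocity q F) g.
Proof.
move=> sF gE; split.
  (* At [t = 0] the correction vanishes because [A 0 = 0]. *)
  by move=> x y z; rewrite velocityE gE Aa.2 !mulr0 subr0 addr0.
by apply: continuous_subspaceT; exact/wave_algebra_continuous/velocity_algebra.
Qed.

Let profile_derive s :
  alpha * derive1 F1 s + beta * derive1 F2 s + gamma * derive1 F3 s = 0.
Proof.
have dF1 := smooth_is_derive sF1 s.
have dF2 := smooth_is_derive sF2 s.
have dF3 := smooth_is_derive sF3 s.
have d : is_derive s 1 (fun s => alpha * F1 s + beta * F2 s + gamma * F3 s)
    (alpha * derive1 F1 s + beta * derive1 F2 s + gamma * derive1 F3 s).
  exact: is_derive_eq.
(* The left side is the derivative of a combination of the profiles that [profile] makes
   constant. *)
rewrite -(derive_val (is_derive := d)) (_ : (fun _ => _) = cst (- delta)).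
  by rewrite derive_cst.
exact/funext.
Qed.

(** The data and the solution enter through pointwise equations, so that explicit formulas can be
    matched to the wave form by ring identities. *)
Lemma transported_wave_solution (g1 g2 g3 : R -> R -> R -> R)
    (u1 u2 u3 p : scalar_field R) :
  (forall x y z, g1 x y z = F1 (alpha * x + beta * y + gamma * z)) ->
  (forall x y z, g2 x y z = F2 (alpha * x + beta * y + gamma * z)) ->
  (forall x y z, g3 x y z = F3 (alpha * x + beta * y + gamma * z)) ->
  (forall x y z t, u1 x y z t =
    F1 (alpha * x + beta * y + gamma * z + delta * t) - q1 * A t) ->
  (forall x y z t, u2 x y z t =
    F2 (alpha * x + beta * y + gamma * z + delta * t) - q2 * A t) ->
  (forall x y z t, u3 x y z t =
    F3 (alpha * x + beta * y + gamma * z + delta * t) - q3 * A t) ->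
  (forall x y z t, p x y z t = a t * (q1 * x + q2 * y + q3 * z) + b t) ->
  smooth_solution g1 g2 g3 u1 u2 u3 p.
Proof.
move=> g1E g2E g3E u1E u2E u3E pE.
have {u1E}-> : u1 = velocity q1 F1.
  by do 4 apply/funext => ?; rewrite u1E velocityE.
have {u2E}-> : u2 = velocity q2 F2.
  by do 4 apply/funext => ?; rewrite u2E velocityE.
have {u3E}-> : u3 = velocity q3 F3.
  by do 4 apply/funext => ?; rewrite u3E velocityE.
have {pE}-> : p = pressure.
  by do 4 apply/funext => ?; rewrite pE /pressure /wave !mul0r !add0r !mul1r addr0.
have d1 := has_gradientE _ _ _ _ _ (d_velocity q1 F1 sF1).
have d2 := has_gradientE _ _ _ _ _ (d_velocity q2 F2 sF2).
have d3 := has_gradientE _ _ _ _ _ (d_velocity q3 F3 sF3).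
have [d1x d1y d1z d1t] := d1.
have [d2x d2y d2z d2t] := d2.
have [d3x d3y d3z d3t] := d3.
split.
- by split; apply/wave_algebra_smooth/velocity_algebra.
- apply/wave_algebra_smooth/wave_algebraD; last exact: wave_algebra_wave sb.
  by apply: wave_algebraM; apply: wave_algebra_wave; [exact: sa|exact: smooth_id].
- move=> x y z t _; have [-> -> ->] := d_pressure x y z t.
  rewrite /advect d1x d1y d1z d1t d2x d2y d2z d2t d3x d3y d3z d3t !velocityE.
  set w := alpha * x + _ + _ + _.
  (* Here [c] stands for the derivative of any of the three profiles at [w]. Factoring it out leaves
     the velocity paired with the wave vector: [profile] evaluates the wave part to [- delta] and
     [orth] removes the part in [A t]. *)
  have transport c : (F1 w - q1 * A t) * (alpha * c) + (F2 w - q2 * A t) * (beta * c)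
      + (F3 w - q3 * A t) * (gamma * c) = - (delta * c).
    transitivity (((alpha * F1 w + beta * F2 w + gamma * F3 w)
      - (alpha * q1 + beta * q2 + gamma * q3) * A t) * c); first by ring.
    by rewrite profile orth; ring.
  (* Advection cancels the [delta] term of the time derivative, and [- q_i * a t] remains on both
     sides. *)
  by rewrite !transport; split; ring.
- move=> x y z t _; rewrite /divergence d1x d2y d3z; exact: profile_derive.
- by split; exact: velocity_init.
Qed.

End TransportedWave.

(** * The two explicit families *)

Lemma primitive0_zero {R : realType} : primitive0 (fun _ : R => 0 : R) (fun _ => 0).
Proof. by split=> // t; exact: is_derive_cst. Qed.

Lemma smooth_zero {R : realType} : smooth (fun _ : R => 0 : R).
Proof.
have -> : (fun _ => 0) = (fun s : R => 0 * s + 0).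
  by apply/funext => s; rewrite mul0r addr0.
exact: smooth_affine smooth_id.
Qed.

Theorem theorem3p1 (R : realType) :
  (forall (c1 c2 ct1 ct2 k l : R) (G : R -> R) (g1 g2 g3 : R -> R -> R -> R),
    smooth G ->
    (forall x y z, g1 x y z = G ((k * c1 + l * c2) * x - k * y - l * z)) ->
    (forall x y z, g2 x y z = c1 * g1 x y z + ct1) ->
    (forall x y z, g3 x y z = c2 * g1 x y z + ct2) ->
    (exists u1 u2 u3 p : scalar_field R, smooth_solution g1 g2 g3 u1 u2 u3 p) /\
    (forall (a b A : R -> R) (u1 u2 u3 p : scalar_field R),
      smooth a -> smooth b -> primitive0 A a ->
      (forall x y z t, u1 x y z t =
         G ((k * ct1 + l * ct2) * t + (k * c1 + l * c2) * x - k * y - l * z)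
         - A t) ->
      (forall x y z t, u2 x y z t = c1 * u1 x y z t + ct1) ->
      (forall x y z t, u3 x y z t = c2 * u1 x y z t + ct2) ->
      (forall x y z t, p x y z t = a t * (x + c1 * y + c2 * z)) ->
      smooth_solution g1 g2 g3 u1 u2 u3 p)) /\
  (forall (c1 c2 : R) (G H : R -> R) (g1 g2 g3 : R -> R -> R -> R),
    c2 != 0 ->
    smooth G -> smooth H ->
    (forall x y z, g1 x y z = G (c2 * z - y)) ->
    (forall x y z, g2 x y z = H (c2 * z - y)) ->
    (forall x y z, g3 x y z = 1 / c2 * g2 x y z - c1 / c2) ->
    (exists u1 u2 u3 p : scalar_field R, smooth_solution g1 g2 g3 u1 u2 u3 p) /\
    (forall (a b A : R -> R) (u1 u2 u3 p : scalar_field R),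
      smooth a -> smooth b -> primitive0 A a ->
      (forall x y z t, u1 x y z t = G (c1 * t - y + c2 * z)) ->
      (forall x y z t, u2 x y z t = H (c1 * t - y + c2 * z) - A t) ->
      (forall x y z t, u3 x y z t =
         1 / c2 * H (c1 * t - y + c2 * z) - 1 / c2 * A t - c1 / c2) ->
      (forall x y z t, p x y z t = a t * (y + z / c2) + b t) ->
      smooth_solution g1 g2 g3 u1 u2 u3 p)).
Proof.
split.
- move=> c1 c2 ct1 ct2 k l G g1 g2 g3 sG g1E g2E g3E.
  have sol (a b A : R -> R) (u1 u2 u3 p : scalar_field R) :
      smooth a -> smooth b -> primitive0 A a ->
      (forall x y z t, u1 x y z t =
         G ((k * ct1 + l * ct2) * t + (k * c1 + l * c2) * x - k * y - l * z) - A t) ->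
      (forall x y z t, u2 x y z t = c1 * u1 x y z t + ct1) ->
      (forall x y z t, u3 x y z t = c2 * u1 x y z t + ct2) ->
      (forall x y z t, p x y z t = a t * (x + c1 * y + c2 * z)) ->
      smooth_solution g1 g2 g3 u1 u2 u3 p.
    move=> sa sb Aa u1E u2E u3E pE.
    have phase x y z : (k * c1 + l * c2) * x - k * y - l * z =
      (k * c1 + l * c2) * x + - k * y + - l * z by ring.
    have phase_t x y z t :
        (k * ct1 + l * ct2) * t + (k * c1 + l * c2) * x - k * y - l * z =
        (k * c1 + l * c2) * x + - k * y + - l * z + (k * ct1 + l * ct2) * t by ring.
    (* The wave vector and [delta] are read off the argument of [G]. Subtracting [A] from [u1]
       subtracts [c1 * A] from [u2] and [c2 * A] from [u3], whence [q = (1, c1, c2)]. In the profile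
       condition the terms in [G] cancel and [- (k * ct1 + l * ct2)] is left. *)
    apply: (transported_wave_solution (alpha := k * c1 + l * c2) (beta := - k)
      (gamma := - l) (delta := k * ct1 + l * ct2) (q1 := 1) (q2 := c1) (q3 := c2)
      (F1 := G) (F2 := fun s => c1 * G s + ct1) (F3 := fun s => c2 * G s + ct2)
      (A := A) (a := a) (b := fun _ => 0)
      sG (smooth_affine c1 ct1 sG) (smooth_affine c2 ct2 sG) sa smooth_zero Aa).
    + by move=> s; ring.
    + by ring.
    + by move=> x y z; rewrite g1E phase.
    + by move=> x y z; rewrite g2E g1E phase.
    + by move=> x y z; rewrite g3E g1E phase.
    + by move=> x y z t; rewrite u1E phase_t; ring.
    + by move=> x y z t; rewrite u2E u1E phase_t; ring.
    + by move=> x y z t; rewrite u3E u1E phase_t; ring.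
    + by move=> x y z t; rewrite pE; ring.
  split; last exact: sol.
  (* Existence is the instance [a = b = A = 0]; the explicit formulas themselves determine the four
     witnesses. *)
  by do 4 eexists; apply: (sol _ _ _ _ _ _ _ smooth_zero smooth_zero primitive0_zero).
- move=> c1 c2 G H g1 g2 g3 c2n0 sG sH g1E g2E g3E.
  have sol (a b A : R -> R) (u1 u2 u3 p : scalar_field R) :
      smooth a -> smooth b -> primitive0 A a ->
      (forall x y z t, u1 x y z t = G (c1 * t - y + c2 * z)) ->
      (forall x y z t, u2 x y z t = H (c1 * t - y + c2 * z) - A t) ->
      (forall x y z t, u3 x y z t =
         1 / c2 * H (c1 * t - y + c2 * z) - 1 / c2 * A t - c1 / c2) ->
      (forall x y z t, p x y z t = a t * (y + z / c2) + b t) ->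
      smooth_solution g1 g2 g3 u1 u2 u3 p.
    move=> sa sb Aa u1E u2E u3E pE.
    have phase (x y z : R) : c2 * z - y = 0 * x + - 1 * y + c2 * z by ring.
    have phase_t (x y z t : R) :
      c1 * t - y + c2 * z = 0 * x + - 1 * y + c2 * z + c1 * t by ring.
    (* The phase is independent of [x], so [alpha = 0] and the profile [G] of [u1] is unconstrained.
       Since [A] is subtracted from [u2] and [A / c2] from [u3], [q = (0, 1, 1 / c2)]. The profile
       condition reads [- H + c2 * (H / c2 - c1 / c2) = - c1] and orthogonality [- 1 + c2 / c2 = 0];
       both rely on [c2 != 0]. *)
    apply: (transported_wave_solution (alpha := 0) (beta := - 1)
      (gamma := c2) (delta := c1) (q1 := 0) (q2 := 1) (q3 := 1 / c2)
      (F1 := G) (F2 := H) (F3 := fun s => 1 / c2 * H s + - (c1 / c2))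
      (A := A) (a := a) (b := b)
      sG sH (smooth_affine (1 / c2) (- (c1 / c2)) sH) sa sb Aa).
    + by move=> s; field.
    + by field.
    + by move=> x y z; rewrite g1E (phase x).
    + by move=> x y z; rewrite g2E (phase x).
    + by move=> x y z; rewrite g3E g2E (phase x).
    + by move=> x y z t; rewrite u1E (phase_t x); ring.
    + by move=> x y z t; rewrite u2E (phase_t x); ring.
    + by move=> x y z t; rewrite u3E (phase_t x); ring.
    + by move=> x y z t; rewrite pE; ring.
  split; last exact: sol.
  by do 4 eexists; apply: (sol _ _ _ _ _ _ _ smooth_zero smooth_zero primitive0_zero).
Qed.
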